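(* Let $G$ be a finite simple graph such that $\operatorname{reg}(\mathbb{K}[G])=1$. Then $\deg h_{\mathbb{K}[G]}(x)=1$.
   Context: $\mathbb{K}$ is an algebraically closed field of characteristic zero. For a finite simple graph $G=(V,E)$ with $V=\{v_1,\dots,v_n\}$, $E=\{e_1,\dots,e_q\}$, the toric ideal $I_G$ is the kernel of $\varphi:\mathbb{K}[e_1,\dots,e_q]\to\mathbb{K}[v_1,\dots,v_n]$, $\varphi(e_i)=v_{i_1}v_{i_2}$ for $e_i=\{v_{i_1},v_{i_2}\}$, and $\mathbb{K}[G]=\mathbb{K}[E]/I_G$ with $\mathbb{K}[E]$ standard graded. $\operatorname{reg}$ is Castelnuovo–Mumford regularity; $h_{\mathbb{K}[G]}(x)$ is the $h$-polynomial, i.e. $HS_{\mathbb{K}[G]}(x)=h(x)/(1-x)^{\dim\mathbb{K}[G]}$ with $h(1)\neq0$. *)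

(* Defs.v *)
From HB Require Import structures.
From mathcomp Require Import all_boot all_order all_algebra.
Set Implicit Arguments. Unset Strict Implicit. Unset Printing Implicit Defensive.
Import Order.TTheory GRing.Theory Num.Theory.

Definition simple_graph (T : finType) (adj : rel T) : Prop :=
  symmetric adj /\ irreflexive adj.

Section ToricRing.
Variables (T : finType) (adj : rel T).

Definition edge_set : {set {set T}} := [set U : {set T} | [exists x : T, exists y : T, adj x y && (U == [set x; y])]].

(* exponent vectors of monomials in the vertex variables *)
Definition inc (U : {set T}) : {ffun T -> nat} := [ffun v => nat_of_bool (v \in U)].
Definition addv (a b : {ffun T -> nat}) : {ffun T -> nat} := [ffun v => a v + b v].

(* K[G] is identified with the image of phi (first isomorphism theorem):
   its degree-n component has as K-basis the distinct vertex monomials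
   phi(e_{i1}...e_{in}); monos n lists their exponent vectors. *)
Fixpoint monos (n : nat) : seq {ffun T -> nat} :=
  match n with
  | 0 => [:: [ffun => 0%N]]
  | n'.+1 => undup [seq addv a (inc e) | a <- monos n', e <- enum edge_set]
  end.

Definition hilb (n : nat) : nat := size (monos n).

(* Koszul complex K(e_1..e_q) (x) K[G]; its homology in homological degree i and
   internal degree j is Tor_i^{K[E]}(K[G], K)_j.  Basis of the (i,j) component
   K[G]_{j-i} (x) /\^i K^E: pairs (monomial, i-subset of edges). *)
Definition kbasis (i j : nat) : seq ({ffun T -> nat} * {set {set T}}) :=
  if i <= j then
    [seq (a, F) | a <- monos (j - i), F <- enum [set F in powerset edge_set | #|F| == i]]
  else [::].

Variable K : fieldType.

Definition ksign (s : {set T}) (F : {set {set T}}) : K :=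
  ((-1) ^+ #|[set t in F | (enum_rank t < enum_rank s)%N]|)%R.

(* coefficient of y in d(x), d(a (x) e_S) = sum_{s in S} sign * (a*phi(e_s)) (x) e_{S\s} *)
Definition kentry (x y : {ffun T -> nat} * {set {set T}}) : K :=
  (\sum_(s in x.2 | (y.2 == x.2 :\ s) && (y.1 == addv x.1 (inc s))) ksign s x.2)%R.

Definition kdflt : {ffun T -> nat} * {set {set T}} := ([ffun => 0%N], set0).

Definition kmat (i j : nat) : 'M[K]_(size (kbasis i j), size (kbasis i.-1 j)) :=
  \matrix_(r, c) kentry (nth kdflt (kbasis i j) r) (nth kdflt (kbasis i.-1 j) c).

Definition krank (i j : nat) : nat := if i is 0 then 0%N else \rank (kmat i j).

Definition betti (i j : nat) : nat := (size (kbasis i j) - krank i j - krank i.+1 j)%N.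

Definition reg_eq (r : nat) : Prop :=
  (exists i j, (i <= j)%N /\ betti i j != 0%N /\ (j - i)%N = r) /\
  (forall i j, (i <= j)%N -> betti i j != 0%N -> (j - i <= r)%N).

End ToricRing.

(* h is the h-polynomial w.r.t. d: HS(x) * (1-x)^d = h(x) as power series, h(1) != 0 *)
Definition is_hpoly (T : finType) (adj : rel T) (d : nat) (h : {poly int}) : Prop :=
  (forall n : nat, (h`_n = \sum_(k < d.+1 | (k <= n)%N)
      ((-1) ^+ k * ('C(d, k))%:R * (hilb adj (n - k))%:R))%R) /\
  (h.[1] != 0)%R.

(* Main.v *)
Require Import Defs.
From HB Require Import structures.
From mathcomp Require Import all_boot all_order all_algebra.
From mathcomp Require Import ring zify.
Import GRing.Theory.
Set Implicit Arguments. Unset Strict Implicit. Unset Printing Implicit Defensive.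

(** Let [q] be the number of edges, [r] the rank of the incidence matrix and
    [c = q - r].  When [reg = 1] the only nonzero Betti numbers besides
    [betti 0 0] lie on the linear strand, so the coefficient of [x^(n+1)] in
    [(1 - x)^q HS(x)] is [± betti n (n+1)].  Green's K_{p,1} theorem says that the
    linear strand of a domain of codimension [c] has length at most [c], so this
    polynomial has degree at most [c + 1].  The Hilbert function is
    [O(n^(r - 1))], so [d <= r], and dividing by [(1 - x)^(q - d)] leaves an
    [h] of degree at most [1].  If [h] were constant, [(1 - x)^q HS(x)] would be a power
    of [1 - x] whose linear coefficient [betti 0 1] is nonnegative, hence [1],
    and the linear strand would vanish.

    For Green's theorem, a cycle of the linear strand is a family
    [u_i : /\^p K^q] indexed by the edges, with slices [u_x = sum_i x_i u_i], such
    that [i_x u_x = 0] for every point [x] of the affine toric variety; it is a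
    boundary iff [i_x u_x = 0] for all [x].  Contract with further toric points
    [y_1, ..., y_(p-1)]: the quadratic form [x |-> i_(y_1) ... i_(y_(p-1)) i_x u_x]
    vanishes on the variety and is invariant under translation by the [y_k].
    Hence it also vanishes on the span of the [y_k] and of the tangent space at
    [(1, ..., 1)], which for [p > c] and general [y_k] is the whole space. *)

(** * Contractions of the exterior algebra *)

(** Uniqueness of binary expansions: parity gives the lowest bit and halving reduces to the
    remaining ones. *)
Lemma binsum_inj n (f g : nat -> bool) :
  \sum_(i < n) f i * 2 ^ i = \sum_(i < n) g i * 2 ^ i ->
  forall i, i < n -> f i = g i.
Proof.
elim: n f g => [|n IHn] f g //.
rewrite !big_ord_recl /= !muln1.
have shift (k : nat -> bool) : \sum_(i < n) k (bump 0 i) * 2 ^ bump 0 i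
    = (\sum_(i < n) k i.+1 * 2 ^ i).*2.
  by rewrite -muln2 big_distrl; apply: eq_bigr => i _; rewrite /= expnSr mulnA.
rewrite !shift => eqfg.
have fg0 : f 0 = g 0.
  by have := congr1 odd eqfg; rewrite !oddD !odd_double !addbF; case: (f 0) (g 0) => [] [].
move: eqfg; rewrite fg0 => /addnI/double_inj eqfg [|i] //.
exact: (IHn (fun i => f i.+1) (fun i => g i.+1)).
Qed.

(** Binary code of a vertex set. Putting [z ^ (2 ^ enum_rank v)] at each vertex [v] gives the edge
    [U] the coordinate [z ^ weight U], so distinct edges get distinct exponents. *)
Definition weight (T : finType) (U : {set T}) : nat := \sum_(v in U) 2 ^ enum_rank v.

Lemma weight_inj (T : finType) : injective (@weight T).
Proof.
pose bit (U : {set T}) := nth false [seq v \in U | v <- enum T].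
have bitE U (i : 'I_#|T|) : bit U i = (enum_val i \in U).
  by rewrite /bit (nth_map (enum_val i)) -?cardE // -enum_val_nth.
have weightE U : weight U = \sum_(i < #|T|) bit U i * 2 ^ i.
  rewrite /weight big_mkcond /= (reindex_onto enum_val enum_rank) /=; last first.
    by move=> v _; rewrite enum_rankK.
  apply: eq_big => [i|i _]; first by rewrite enum_valK eqxx.
  by rewrite enum_valK bitE; case: (_ \in U); rewrite ?mul1n ?mul0n.
move=> U V; rewrite !weightE => /binsum_inj eqUV.
apply/setP => v; have := eqUV (enum_rank v) (ltn_ord _).
by rewrite !bitE enum_rankK.
Qed.

(** * Polynomial identities in characteristic zero *)

Section CharZero.
Local Open Scope ring_scope.
Variables (K : fieldType) (char0 : [pchar K] =i pred0).

Lemma natr_inj_char0 : injective (fun n : nat => n%:R : K).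
Proof.
have natr0 := (pcharf0P K).1 char0.
have le_inj m n : (m <= n)%N -> m%:R = n%:R :> K -> m = n.
  move=> le_mn /eqP; rewrite eq_sym -subr_eq0 -natrB // natr0; lia.
by move=> m n eq_mn; case: (leqP m n) => [|/ltnW] /le_inj // ->.
Qed.

Lemma poly_eval0 (p : {poly K}) : (forall z, p.[z] = 0) -> p = 0.
Proof.
move=> p0; apply/eqP/negPn/negP => p_neq0.
have := @max_poly_roots _ p [seq n%:R | n <- iota 0 (size p)] p_neq0.
rewrite size_map size_iota ltnn => contra; suff: false by []; apply: contra.
  by apply/allP => z _; rewrite /root p0.
by rewrite map_inj_uniq ?iota_uniq //; apply: natr_inj_char0.
Qed.

Lemma sum_monomials_eq0 n (c : 'I_n -> K) (w : 'I_n -> nat) : injective w ->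
  \sum_i c i *: 'X^(w i) = 0 :> {poly K} -> forall i, c i = 0.
Proof.
move=> w_inj sum0 i; have := congr1 (coefp (w i)) sum0.
rewrite /= coef0 coef_sum (bigD1 i) //= coefZ coefXn eqxx mulr1 big1 ?addr0 //.
by move=> j neq_ji; rewrite coefZ coefXn (inj_eq w_inj) eq_sym (negPf neq_ji) mulr0.
Qed.

End CharZero.

Section Contraction.
Local Open Scope ring_scope.
Variables (T : finType) (K : fieldType).
Implicit Types (s t : {set T}) (F : {set {set T}}).

Lemma ksignU1 s t F : s \notin F ->
  ksign K t (s |: F) = (-1) ^+ (enum_rank s < enum_rank t)%N * ksign K t F.
Proof.
move=> sF; rewrite /ksign -exprD; congr (_ ^+ _).
rewrite (cardsD1 s) !inE eqxx /=; congr (_ + _)%N.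
apply: eq_card => x; rewrite !inE.
by case: eqP => [->|] //=; rewrite (negPf sF).
Qed.

Lemma ksignU1_same s F : ksign K s (s |: F) = ksign K s F.
Proof.
rewrite /ksign; congr (_ ^+ _); apply: eq_card => x; rewrite !inE.
by case: eqP => [->|] //=; rewrite ltnn andbF.
Qed.

Lemma ksign_sqr s F : ksign K s F * ksign K s F = 1.
Proof. by rewrite /ksign -exprD addnn -signr_odd odd_double. Qed.

(** Of the two comparisons between the ranks of [s] and [t] exactly one holds, which contributes a
    single extra sign. *)
Lemma ksign_swap s t F : s != t -> s \notin F -> t \notin F ->
  ksign K s F * ksign K t (s |: F) = - (ksign K t F * ksign K s (t |: F)).
Proof.
move=> neq_st sF tF; rewrite !ksignU1 //.
have : (enum_rank s != enum_rank t) by rewrite (inj_eq enum_rank_inj).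
by rewrite -val_eqE /=; case: ltngtP => //= _ _; ring.
Qed.

Variables (q : nat) (e : 'I_q -> {set T}) (e_inj : injective e).
Implicit Types (x y : 'rV[K]_q) (f g : {set {set T}} -> K).

(** Interior product with the linear form [x], where [f] lists the coefficients of an element of the
    exterior algebra in the basis indexed by edge sets; the signs are those of the Koszul
    differential. *)
Definition contr x f F : K :=
  \sum_(i | e i \notin F) ksign K (e i) F * x 0 i * f (e i |: F).

Lemma contr_ext x f g : (forall F, f F = g F) -> forall F, contr x f F = contr x g F.
Proof. by move=> fg F; apply: eq_bigr => i _; rewrite fg. Qed.

Lemma contr0 x f : (forall F, f F = 0) -> forall F, contr x f F = 0.
Proof. by move=> f0 F; apply: big1 => i _; rewrite f0 mulr0. Qed.

Lemma contr_linl a x y f F : contr (a *: x + y) f F = a * contr x f F + contr y f F.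
Proof.
rewrite /contr big_distrr -big_split; apply: eq_bigr => i _ /=.
by rewrite !mxE; ring.
Qed.

Lemma contr_linr x a f g F :
  contr x (fun G => a * f G + g G) F = a * contr x f F + contr x g F.
Proof. by rewrite /contr big_distrr -big_split; apply: eq_bigr => i _ /=; ring. Qed.

Lemma contrC x y f F : contr x (contr y f) F = - contr y (contr x f) F.
Proof.
have contr2E x' y' : contr x' (contr y' f) F = \sum_i \sum_j
    if [&& e i \notin F, e j \notin F & i != j] then
      ksign K (e i) F * ksign K (e j) (e i |: F) * x' 0 i * y' 0 j
      * f (e i |: (e j |: F)) else 0.
  rewrite /contr big_mkcond; apply: eq_bigr => i _.
  case: ifP => [iF|_]; last by rewrite big1.
  rewrite big_distrr /= big_mkcond; apply: eq_bigr => j _.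
  rewrite !inE negb_or (inj_eq e_inj) [j == i]eq_sym andbC.
  by case: ifP => // _; rewrite (setUCA [set e j]); ring.
rewrite !contr2E exchange_big /= -sumrN; apply: eq_bigr => j _.
rewrite -sumrN; apply: eq_bigr => i _.
rewrite (eq_sym i j) andbCA; case: ifP => [/and3P[jF iF neq_ji]|]; rewrite ?oppr0 //.
rewrite ksign_swap ?(inj_eq e_inj) // 1?eq_sym // (setUCA [set e i]).
by ring.
Qed.

Lemma contr_sqr x f F : (2%:R != 0 :> K) -> contr x (contr x f) F = 0.
Proof.
move=> two_neq0; have /eqP := contrC x x f F.
rewrite -subr_eq0 opprK -mulr2n -mulr_natl mulf_eq0 (negPf two_neq0) /=.
by move/eqP.
Qed.

Fixpoint contrs (ys : seq 'rV[K]_q) f : {set {set T}} -> K :=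
  if ys is y :: ys' then contr y (contrs ys' f) else f.

Lemma contrs_linr ys a f g F :
  contrs ys (fun G => a * f G + g G) F = a * contrs ys f F + contrs ys g F.
Proof.
elim: ys F => //= y ys IHys F; rewrite -contr_linr.
exact: contr_ext.
Qed.

Lemma contrs_ext ys f g : (forall F, f F = g F) -> forall F, contrs ys f F = contrs ys g F.
Proof. by move=> fg; elim: ys => //= y ys; apply: contr_ext. Qed.

Lemma contrs0 ys f : (forall F, f F = 0) -> forall F, contrs ys f F = 0.
Proof. by move=> f0; elim: ys => //= y ys; apply: contr0. Qed.

Lemma contr_contrs0 ys y f : (forall F, contr y f F = 0) ->
  forall F, contr y (contrs ys f) F = 0.
Proof.
move=> yf0; elim: ys => //= z ys IHys F.
by rewrite contrC (contr0 _ IHys) oppr0.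
Qed.

(** Contractions anticommute, so the one by [y] can be moved inwards until it meets [f]. *)
Lemma contrs_mem0 ys y f : y \in ys -> (forall F, contr y f F = 0) ->
  forall F, contrs ys f F = 0.
Proof.
move=> y_ys yf0; elim: ys y_ys => //= z ys IHys; rewrite inE.
case/predU1P=> [<-|/IHys IH] F; first exact: contr_contrs0.
exact: contr0.
Qed.

End Contraction.

(** * Quadratic forms vanishing on the toric variety *)

Section LinearSyzygies.
Local Open Scope ring_scope.
Variables (T : finType) (K : fieldType) (q : nat) (e : 'I_q -> {set T}).
Hypotheses (char0 : [pchar K] =i pred0) (e_inj : injective e).
Hypothesis card_e : forall i, #|e i| = 2%N.
Implicit Types (F : {set {set T}}) (x y : 'rV[K]_q).

Definition toric_point (t : T -> K) : 'rV[K]_q := \row_i \prod_(v in e i) t v.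

(** As every edge has two endpoints, [w *m incidence] is the derivative of [toric_point] at the
    all-ones point in direction [w]: the row space is the tangent space there. *)
Definition incidence : 'M[K]_(#|T|, q) := \matrix_(v, i) (enum_val v \in e i)%:R.

Definition span_rows (ys : seq 'rV[K]_q) : 'M[K]_q := foldr (fun y U => y + U)%MS 0 ys.

Variable u : 'I_q -> {set {set T}} -> K.

Definition slice x F : K := \sum_i x 0 i * u i F.

Hypothesis cycle_u : forall t F,
  contr e (toric_point t) (slice (toric_point t)) F = 0.

Let two_neq0 : 2%:R != 0 :> K.
Proof. by rewrite ((pcharf0P K).1 char0). Qed.

Lemma slice_lin a x y F : slice (a *: x + y) F = a * slice x F + slice y F.
Proof.
rewrite /slice big_distrr -big_split; apply: eq_bigr => i _ /=.
by rewrite !mxE; ring.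
Qed.

Section Polarization.
Variables (ys : seq 'rV[K]_q) (F : {set {set T}}).

(** Bilinear form whose diagonal is the quadratic form to be killed. It need not be symmetric, so
    both orders of the arguments are tracked below. *)
Let b x y := contrs e ys (contr e x (slice y)) F.

Let b_linl a x y z : b (a *: x + y) z = a * b x z + b y z.
Proof.
rewrite /b -contrs_linr; apply: contrs_ext => G.
exact: contr_linl.
Qed.

Let b_linr a x y z : b z (a *: x + y) = a * b z x + b z y.
Proof.
rewrite /b -contrs_linr; apply: contrs_ext => G.
rewrite -contr_linr; apply: contr_ext => G'; exact: slice_lin.
Qed.

Let b0l z : b 0 z = 0.
Proof. by have := b_linl (-1) 0 0 z; rewrite scaler0 addr0 mulN1r addNr. Qed.

Let b0r z : b z 0 = 0.
Proof. by have := b_linr (-1) 0 0 z; rewrite scaler0 addr0 mulN1r addNr. Qed.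

Hypothesis ys_toric : forall y, y \in ys -> exists t, y = toric_point t.

Let b_mem y z : y \in ys -> b y z = 0 /\ b z y = 0.
Proof.
move=> y_ys; have [t yE] := ys_toric y_ys.
(* For [b y z] the point [y] is contracted twice; for [b z y] anticommutation exposes the cycle
   condition at [y]. *)
split; apply: (contrs_mem0 e_inj y_ys) => G; first exact: contr_sqr.
by rewrite contrC // contr0 ?oppr0 // => G'; rewrite yE cycle_u.
Qed.

Let b_span y z : (y <= span_rows ys)%MS -> b y z = 0 /\ b z y = 0.
Proof.
have : {subset ys <= ys} by [].
elim: {1 3}ys y => [|y' s IHs] y sub_s /=.
  by move/submx0null => ->; rewrite b0l b0r.
case/sub_addsmxP=> [[c d]] /= ->.
have [] := IHs (d *m span_rows s).
- by move=> y1 y1_s; apply: sub_s; rewrite inE y1_s orbT.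
- exact: submxMl.
have [] := b_mem z (sub_s y' (mem_head _ _)).
rewrite (mx11_scalar c) mul_scalar_mx => y'z zy' dz zd.
by rewrite b_linl b_linr y'z zy' dz zd mulr0 addr0.
Qed.

Let one : 'rV[K]_q := toric_point (fun=> 1).

(* Along the curve [s |-> toric_point (1 + s w)] the quadratic form [b x x]
   vanishes; the coefficients of [s] and [s ^ 2] give the claim below. *)
Let b_tangent w (d := w *m incidence) (n := toric_point (fun v => w 0 (enum_rank v))) :
  b one d + b d one = 0 /\ b d d + b one n + b n one = 0.
Proof.
have curveE s : toric_point (fun v => 1 + s * w 0 (enum_rank v)) = s *: (s *: n + d) + one.
  apply/rowP => i; rewrite !mxE.
  have /eqP/cards2P[v1 [v2 [neq_v eiE]]] := card_e i.
  have prod2 (f : T -> K) : \prod_(v in e i) f v = f v1 * f v2.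
    by rewrite eiE big_setU1 ?inE //= big_set1.
  have -> : \sum_j w 0 j * incidence j i = w 0 (enum_rank v1) + w 0 (enum_rank v2).
    transitivity (\sum_(v in e i) w 0 (enum_rank v)).
      rewrite [RHS]big_mkcond [RHS](reindex_onto enum_val enum_rank) /=; last first.
        by move=> v _; rewrite enum_rankK.
      apply: eq_big => [j|j _]; first by rewrite enum_valK eqxx.
      by rewrite mxE enum_valK; case: ifP => _; rewrite ?mulr1 ?mulr0.
    by rewrite eiE big_setU1 ?inE //= big_set1.
  by rewrite !prod2; ring.
have bE s : s * (b one d + b d one) + s ^+ 2 * (b d d + b one n + b n one)
          + s ^+ 3 * (b d n + b n d) + s ^+ 4 * b n n = 0.
  have : b (s *: (s *: n + d) + one) (s *: (s *: n + d) + one) = 0.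
    rewrite -curveE; apply: contrs0 => G; exact: cycle_u.
  have b11 : b one one = 0 by apply: contrs0 => G; exact: cycle_u.
  by rewrite !(b_linl, b_linr) b11 => b0; rewrite -[RHS]b0; ring.
set c1 := b one d + b d one in bE *; set c2 := b d d + b one n + b n one in bE *.
set c3 := b d n + b n d in bE; set c4 := b n n in bE.
have : c1 *: 'X + c2 *: 'X^2 + c3 *: 'X^3 + c4 *: 'X^4 = 0 :> {poly K}.
  apply: (poly_eval0 char0) => s; rewrite !(hornerD, hornerZ, hornerXn, hornerX) -[RHS](bE s).
  by ring.
move=> p0; split.
  by have := congr1 (coefp 1) p0; rewrite /= !(coefD, coefZ, coefX, coefXn, coef0) /= !mulr0 !addr0 mulr1.
by have := congr1 (coefp 2) p0; rewrite /= !(coefD, coefZ, coefX, coefXn, coef0) /= !mulr0 !addr0 add0r mulr1.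
Qed.

(** Write [x] as a tangent vector [d] plus an element of the span of [ys]; the latter drops out by
    [b_span], and [b d d] is minus the symmetrized value at [one] and [n], which vanishes as
    well. *)
Lemma contrs_slice_full : row_full (incidence + span_rows ys)%MS ->
  forall x, contrs e ys (contr e x (slice x)) F = 0.
Proof.
move=> full x; rewrite -/(b x x).
have decomp z : exists w z', [/\ z = 1 *: (w *m incidence) + z', b z' =1 fun=> 0 & b^~ z' =1 fun=> 0].
  have /sub_addsmxP[[w d] /= zE] : (z <= incidence + span_rows ys)%MS by rewrite submx_full.
  exists w, (d *m span_rows ys); split; first by rewrite scale1r.
    by move=> z'; case: (b_span z' (submxMl d (span_rows ys))).
  by move=> z'; case: (b_span z' (submxMl d (span_rows ys))).
(* The first-order identity handles the tangent part of an arbitrary [z]; this is needed for [n],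
   which is not assumed to be tangent. *)
have one0 z : b one z + b z one = 0.
  have [w [z' [-> bz' bz'r]]] := decomp z.
  by rewrite b_linl b_linr bz' bz'r !addr0 !mul1r; case: (b_tangent w).
have [w [x' [-> bx' bx'r]]] := decomp x.
rewrite !(b_linl, b_linr) !bx' !bx'r !mul1r !addr0.
by have [_] := b_tangent w; rewrite -addrA one0 addr0.
Qed.

End Polarization.

(* The points are chosen on the monomial curve [z |-> (z ^ weight (e i))_i]: a nonzero
   linear form has finitely many zeros on it, so points outside any given proper
   subspace still suffice to test the vanishing of a linear form. *)
Lemma contrs_slice_eq0 k ys F : (forall y, y \in ys -> exists t, y = toric_point t) ->
  (q <= \rank (incidence + span_rows ys)%MS + k)%N ->
  #|F| = k -> F \subset [set e i | i : 'I_q] ->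
  forall x, contrs e ys (contr e x (slice x)) F = 0.
Proof.
elim: k ys F => [|k IHk] ys F ys_toric rank_ys cardF subF x.
  apply: contrs_slice_full => //; rewrite /row_full eqn_leq rank_leq_col.
  by rewrite addn0 in rank_ys.
have /card_gt0P[s sF] : (0 < #|F|)%N by rewrite cardF.
have /imsetP[i0 _ sE] := subsetP subF s sF; rewrite {}sE {s} in sF.
(* Up to sign, the target value at [F] is the coefficient of exponent [weight (e i0)] in the
   contraction by [y z] at [F'], seen as a polynomial in [z]. It suffices that this polynomial
   vanishes. *)
set F' := F :\ e i0.
set G := contrs e ys (contr e x (slice x)).
set U := (incidence + span_rows ys)%MS in rank_ys.
pose y z : 'rV[K]_q := \row_i z ^+ weight (e i).
have y_toric z : y z = toric_point (fun v => z ^+ (2 ^ enum_rank v)).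
  by apply/rowP => i; rewrite !mxE prodrXr.
have w_inj : injective (fun i => weight (e i)) by move=> i j /weight_inj/e_inj.
have F'0 z : (q <= \rank (y z + U)%MS + k)%N -> contr e (y z) G F' = 0.
  move=> rank_z; apply: (IHk (y z :: ys)) => //.
  - by move=> y'; rewrite inE => /predU1P[->|/ys_toric //]; rewrite y_toric; eexists.
  - by rewrite /= addsmxA (addsmxC incidence) -addsmxA.
  - by move: cardF; rewrite (cardsD1 (e i0)) sF add1n => -[].
  - exact: subset_trans (subsetDl _ _) subF.
(* Either [y z] lies in [U], where [l] vanishes, or it raises the rank and the induction hypothesis
   kills the contraction. *)
have curve0 (l : 'cV[K]_q) : l != 0 -> U *m l = 0 -> forall z, contr e (y z) G F' * (y z *m l) 0 0 = 0.
  move=> nz_l Ul0 z.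
  have [yzU|yzU] := boolP (y z <= U)%MS.
    by case/submxP: yzU => m ->; rewrite -mulmxA Ul0 mulmx0 mxE mulr0.
  rewrite F'0 ?mul0r //; apply: leq_trans rank_ys _; rewrite addnS -addSn leq_add2r.
  have : (U < y z + U)%MS by rewrite ltmxE addsmxSr addsmx_sub submx_refl andbT.
  by rewrite ltmxErank => /andP[].
have poly_y (c : 'I_q -> K) z : (\sum_i c i *: 'X^(weight (e i))).[z] = \sum_i y z 0 i * c i.
  by rewrite horner_sum; apply: eq_bigr => i _; rewrite !hornerE mxE mulrC.
have G0 : \sum_i (if e i \notin F' then ksign K (e i) F' * G (e i |: F') else 0)
          *: 'X^(weight (e i)) = 0 :> {poly K}.
  set p := LHS.
  have pE z : p.[z] = contr e (y z) G F'.
    rewrite poly_y /contr [RHS]big_mkcond; apply: eq_bigr => i _.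
    by case: ifP => _; rewrite ?mulr0 //; ring.
  have [rk_lt|rk_ge] := ltnP (\rank U) q; last first.
    apply: (poly_eval0 char0) => z; rewrite pE F'0 //.
    by apply: leq_trans rk_ge _; apply: leq_trans (leq_addr _ _); rewrite mxrankS ?addsmxSr.
  (* When [U] is proper, a nonzero column of its cokernel is a nonzero linear form vanishing on
     [U]. *)
  have [j nz_j] : exists j, col j (cokermx U) != 0.
    apply/existsP; apply: contraLR rk_lt => /existsPn col0; rewrite -leqNgt.
    rewrite -subn_eq0 -mxrank_coker mxrank_eq0; apply/eqP/matrixP => a c.
    by have /negPn/eqP/colP/(_ a) := col0 c; rewrite !mxE.
  set l := col j _ in nz_j.
  have Ul0 : U *m l = 0 by rewrite /l colE mulmxA mulmx_coker mul0mx.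
  pose r : {poly K} := \sum_i l i 0 *: 'X^(weight (e i)).
  (* [r] is the restriction of [l] to the curve; it is nonzero because the exponents are distinct,
     so [p] must be zero. *)
  have : p * r = 0.
    apply: (poly_eval0 char0) => z; rewrite hornerM pE poly_y.
    by have := curve0 l nz_j Ul0 z; rewrite mxE.
  move/eqP; rewrite mulf_eq0 => /orP[/eqP //|/eqP r0].
  by case/eqP: nz_j; apply/colP => i; rewrite (sum_monomials_eq0 w_inj r0) mxE.
have := sum_monomials_eq0 w_inj G0 i0; rewrite setD11 /= setD1K //.
move/eqP; rewrite mulf_eq0 => /orP[|/eqP //].
by rewrite /ksign signr_eq0.
Qed.

End LinearSyzygies.

(** * The Koszul complex *)

Section Koszul.
Local Open Scope ring_scope.
Variables (T : finType) (adj : rel T) (K : fieldType).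
Implicit Types (s t : {set T}) (F : {set {set T}}) (a : {ffun T -> nat}).
Implicit Types (x y : {ffun T -> nat} * {set {set T}}).
Notation E := (edge_set adj).
Notation B := (kbasis adj).

Lemma inc_inj : injective (@inc T).
Proof.
move=> s t /ffunP eq_st; apply/setP => v; have := eq_st v.
by rewrite !ffunE; case: (v \in s); case: (v \in t).
Qed.

Lemma addvA : associative (@Defs.addv T).
Proof. by move=> a b c; apply/ffunP => v; rewrite !ffunE addnA. Qed.

Lemma addvC : commutative (@Defs.addv T).
Proof. by move=> a b; apply/ffunP => v; rewrite !ffunE addnC. Qed.

Lemma add0v : left_id [ffun=> 0%N] (@Defs.addv T).
Proof. by move=> a; apply/ffunP => v; rewrite !ffunE. Qed.

Lemma monos_uniq n : uniq (monos adj n).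
Proof. by case: n => //= n; apply: undup_uniq. Qed.

Lemma monosS a s n : a \in monos adj n -> s \in E -> Defs.addv a (inc s) \in monos adj n.+1.
Proof.
by move=> an sE; rewrite mem_undup; apply: allpairs_f; rewrite ?mem_enum.
Qed.

Lemma monos1P a : reflect (exists2 s, s \in E & a = inc s) (a \in monos adj 1).
Proof.
apply: (iffP idP) => [|[s sE ->]]; last by rewrite -[inc s]add0v monosS ?mem_head.
rewrite mem_undup => /allpairsP[[b s]] /= [].
by rewrite inE mem_enum => /eqP-> sE ->; exists s; rewrite ?add0v.
Qed.

Lemma mem_kbasis i j x : (x \in B i j) =
  [&& i <= j, x.1 \in monos adj (j - i), x.2 \subset E & #|x.2| == i]%N.
Proof.
rewrite /kbasis; case: ifP => //= le_ij.
apply/allpairsP/idP => [[[a F]] /= []|/and3P[x1 x2 cx]].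
  by rewrite mem_enum !inE => aM FE ->; rewrite aM.
by exists x; rewrite /= mem_enum !inE x1 x2 cx; case: x {x1 x2 cx}.
Qed.

Lemma kbasis_uniq i j : uniq (B i j).
Proof.
rewrite /kbasis; case: ifP => // _.
by apply: allpairs_uniq; rewrite ?monos_uniq ?enum_uniq // => -[a F] [b G] _ _ /= [-> ->].
Qed.

Lemma size_kbasis i j : (i <= j)%N -> size (B i j) = (hilb adj (j - i) * 'C(#|E|, i))%N.
Proof.
move=> le_ij; rewrite /kbasis le_ij size_allpairs -cardE -cards_draws; congr (_ * _)%N.
by apply: eq_card => F; rewrite !inE.
Qed.

Lemma sum_kbasis i j (f : _ -> K) :
  \sum_(c < size (B i j)) f (nth (kdflt T) (B i j) c) = \sum_(y <- B i j) f y.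
Proof. by rewrite (big_nth (kdflt T)) big_mkord. Qed.

Lemma kentryE x y : kentry K x y =
  \sum_(s in x.2) ksign K s x.2 * (y == (Defs.addv x.1 (inc s), x.2 :\ s))%:R.
Proof.
rewrite /kentry big_mkcondr; apply: eq_bigr => s _ /=.
by rewrite andbC -xpair_eqE -surjective_pairing; case: eqP; rewrite ?mulr1 ?mulr0.
Qed.

Lemma kbasis_boundary i j x s : x \in B i.+1 j -> s \in x.2 ->
  (Defs.addv x.1 (inc s), x.2 :\ s) \in B i j.
Proof.
rewrite !mem_kbasis => /and4P[lt_ij x1 x2 cx] sx /=.
rewrite ltnW // -subnSK // monosS ?(subsetP x2) //=.
rewrite (subset_trans (subsetDl _ _)) //=.
by move: cx; rewrite (cardsD1 s) sx.
Qed.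

Lemma sum_kentry i j x (f : _ -> K) : x \in B i.+1 j ->
  \sum_(y <- B i j) kentry K x y * f y =
  \sum_(s in x.2) ksign K s x.2 * f (Defs.addv x.1 (inc s), x.2 :\ s).
Proof.
move=> xB.
transitivity (\sum_(y <- B i j) \sum_(s in x.2)
   ksign K s x.2 * (y == (Defs.addv x.1 (inc s), x.2 :\ s))%:R * f y).
  by apply: eq_bigr => y _; rewrite kentryE big_distrl.
rewrite exchange_big; apply: eq_bigr => s sx /=.
rewrite (bigD1_seq _ (kbasis_boundary xB sx) (kbasis_uniq _ _)) /= eqxx mulr1.
by rewrite big1 ?addr0 // => y /negPf->; rewrite mulr0 mul0r.
Qed.

Lemma kentry_inc s F G : kentry K ([ffun=> 0%N], F) (inc s, G) =
  ((s \in F) && (G == F :\ s))%:R * ksign K s F.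
Proof.
rewrite kentryE /=; have [sF|sF] := boolP (s \in F); last first.
  rewrite mul0r; apply: big1 => t tF; rewrite xpair_eqE add0v (inj_eq inc_inj).
  by case: eqP => [st|]; rewrite ?mulr0 //; rewrite st tF in sF.
rewrite (bigD1 s) //= big1 ?addr0 => [|t /andP[_ neq_ts]].
  by rewrite xpair_eqE add0v eqxx mulrC.
by rewrite xpair_eqE add0v (inj_eq inc_inj) eq_sym (negPf neq_ts) mulr0.
Qed.

Hypothesis char0 : [pchar K] =i pred0.

Lemma kmat_mul i j : kmat adj K i.+2 j *m kmat adj K i.+1 j = 0.
Proof.
apply/matrixP => r c; rewrite !mxE.
set x := nth (kdflt T) (B i.+2 j) r; set z := nth (kdflt T) (B i j) c.
have xB : x \in B i.+2 j by apply: mem_nth.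
under eq_bigr => k _ do rewrite !mxE.
rewrite (sum_kbasis _ _ (fun y => kentry K x y * kentry K y z)) (sum_kentry _ xB).
under eq_bigr => s _ do rewrite kentryE /= big_distrr /=.
pose g s t := ksign K s x.2 * (ksign K t (x.2 :\ s) *
  (z == (Defs.addv (Defs.addv x.1 (inc s)) (inc t), (x.2 :\ s) :\ t))%:R).
pose S := \sum_(s in x.2) \sum_(t in x.2 | s != t) g s t.
transitivity S.
  by apply: eq_bigr => s _; apply: eq_bigl => t; rewrite !inE andbC eq_sym.
(* Removing [s] and [t] in the other order flips the sign, so the sum is its own negative; 2 is
   invertible. *)
have SN : S = - S.
  rewrite {1}/S (exchange_big_dep (mem x.2)) /=; last by move=> s t _ /andP[].
  rewrite -sumrN; apply: eq_bigr => t tx; rewrite -sumrN.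
  apply: eq_big => [s|s /andP[sx /andP[_ neq_st]]]; first by rewrite tx eq_sym.
  have sF : s \notin x.2 :\ s :\ t by rewrite !inE eqxx andbF.
  have tF : t \notin x.2 :\ s :\ t by rewrite !inE eqxx.
  have xsE : x.2 :\ s = t |: (x.2 :\ s :\ t).
    by rewrite setD1K // !inE eq_sym neq_st.
  have xstC : x.2 :\ s :\ t = x.2 :\ t :\ s by rewrite !setDDl setUC.
  have xtE : x.2 :\ t = s |: (x.2 :\ s :\ t).
    by rewrite xstC setD1K // !inE neq_st.
  have xE : x.2 = s |: (t |: (x.2 :\ s :\ t)) by rewrite -xsE setD1K.
  have stF : s \notin t |: (x.2 :\ s :\ t) by rewrite -xsE !inE eqxx.
  have tsF : t \notin s |: (x.2 :\ s :\ t) by rewrite -xtE !inE eqxx.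
  rewrite /g -!addvA (addvC (inc t)) -xstC.
  rewrite !mulrA -mulNr; congr (_ * _).
  have s1 : ksign K s x.2 = ksign K s (t |: (x.2 :\ s :\ t)).
    by rewrite {1}xE ksignU1_same.
  have t1 : ksign K t x.2 = ksign K t (s |: (x.2 :\ s :\ t)).
    by rewrite {1}xE setUCA ksignU1_same.
  have s2 : ksign K s (x.2 :\ t) = ksign K s (x.2 :\ s :\ t).
    by rewrite {1}xtE ksignU1_same.
  have t2 : ksign K t (x.2 :\ s) = ksign K t (x.2 :\ s :\ t).
    by rewrite {1}xsE ksignU1_same.
  by rewrite s1 t1 s2 t2 mulrC [in RHS]mulrC (ksign_swap _ neq_st) ?opprK.
apply/eqP; have /eqP := SN; rewrite -subr_eq0 opprK -mulr2n -mulr_natl mulf_eq0.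
by rewrite ((pcharf0P K).1 char0).
Qed.

(** Consequence of the boundary squaring to zero; it ensures that the truncated subtractions in
    [betti] are exact. *)
Lemma rank_kmat_le i j : (krank adj K i j + krank adj K i.+1 j <= size (B i j))%N.
Proof.
case: i => [|i]; first by rewrite add0n rank_leq_col.
by rewrite addnC mulmx0_rank_max // kmat_mul.
Qed.


(** On constant coefficients the boundary map is injective in positive homological degree. *)
Lemma betti_diag n : betti adj K n.+1 n.+1 = 0%N.
Proof.
rewrite /betti /krank.
have -> : \rank (kmat adj K n.+1 n.+1) = size (B n.+1 n.+1); last by rewrite subnn.
apply/eqP; rewrite -/(row_free _) -kermx_eq0; apply/rowV0P => v /sub_kermxP v0.
apply/rowP => r; rewrite mxE.
have nthE (r' : 'I_(size (B n.+1 n.+1))) :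
    nth (kdflt T) (B n.+1 n.+1) r' = ([ffun=> 0%N], (nth (kdflt T) (B n.+1 n.+1) r').2).
  have : nth (kdflt T) (B n.+1 n.+1) r' \in B n.+1 n.+1 by apply: mem_nth.
  rewrite mem_kbasis subnn /= inE => /and3P[_ /eqP x1 _].
  by rewrite {1}[nth _ _ _]surjective_pairing x1.
have xB : nth (kdflt T) (B n.+1 n.+1) r \in B n.+1 n.+1 by apply: mem_nth.
set F := (nth (kdflt T) (B n.+1 n.+1) r).2.
have /card_gt0P[s sF] : (0 < #|F|)%N.
  by move: xB; rewrite mem_kbasis => /and4P[_ _ _ /eqP->].
have yB : (inc s, F :\ s) \in B n n.+1.
  by have := kbasis_boundary xB sF; rewrite nthE add0v.
(* Only the row of [F] meets this column: the monomial recovers [s], and then [F :\ s] recovers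
   [F]. *)
have c_lt : (index (inc s, F :\ s) (B n n.+1) < size (B n n.+1))%N by rewrite index_mem.
have /rowP/(_ (Ordinal c_lt)) := v0; rewrite !mxE (bigD1 r) //= big1.
  rewrite addr0 mxE /= nth_index // nthE kentry_inc sF eqxx mul1r.
  by move/eqP; rewrite mulf_eq0 signr_eq0 orbF => /eqP.
move=> r' neq_r; rewrite mxE /= nth_index // nthE kentry_inc.
case: andP => [[sF' /eqP eqF]|]; last by rewrite mul0r mulr0.
case/eqP: neq_r; apply/val_inj/eqP; rewrite -(nth_uniq (kdflt T) (ltn_ord r') (ltn_ord r) (kbasis_uniq n.+1 n.+1)).
by rewrite nthE [X in _ == X]nthE -(setD1K sF') -eqF -/F setD1K.
Qed.

Definition edge (i : 'I_#|E|) : {set T} := enum_val i.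

Lemma edge_inj : injective edge.
Proof. exact: enum_val_inj. Qed.

Lemma edge_in i : edge i \in E.
Proof. exact: enum_valP. Qed.

Lemma edgeP s : s \in E -> exists i, s = edge i.
Proof. by move=> sE; exists (enum_rank_in sE s); rewrite /edge enum_rankK_in. Qed.

Lemma sum_edges F (f : _ -> K) : F \subset E ->
  \sum_(s in F) f s = \sum_(i | edge i \in F) f (edge i).
Proof.
move=> FE; rewrite big_mkcond [RHS]big_mkcond /edge.
rewrite -(big_enum_val (fun s => if s \in F then f s else 0)).
rewrite [RHS]big_mkcond; apply: eq_bigr => s _.
by case: ifP => sF; case: ifP => // sE; rewrite (subsetP FE) in sE.
Qed.

Definition mono (t : T -> K) a : K := \prod_v t v ^+ a v.

Lemma mono_inc (t : T -> K) s : mono t (inc s) = \prod_(v in s) t v.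
Proof.
rewrite /mono [RHS]big_mkcond; apply: eq_bigr => v _.
by rewrite ffunE; case: (v \in s).
Qed.

Lemma monoD (t : T -> K) a b : mono t (Defs.addv a b) = mono t a * mono t b.
Proof. by rewrite /mono -big_split; apply: eq_bigr => v _; rewrite ffunE exprD. Qed.

(** * Cycles and boundaries of the linear strand *)

Section LinearStrand.
Variables (p : nat) (u : 'rV[K]_(size (B p.+1 p.+2))).
Local Notation x_ r := (nth (kdflt T) (B p.+1 p.+2) r).

(** Turns the chain [u] into a family of exterior elements indexed by the edges: degree-one
    monomials are exactly the edge monomials. *)
Definition coef (i : 'I_#|E|) F : K := \sum_r u 0 r * (x_ r == (inc (edge i), F))%:R.

Lemma coef_nth (r : 'I_(size (B p.+1 p.+2))) i F : x_ r = (inc (edge i), F) -> coef i F = u 0 r.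
Proof.
move=> xr; rewrite /coef (bigD1 r) //= xr eqxx mulr1 big1 ?addr0 // => r' neq_r.
by rewrite -xr (nth_uniq _ (ltn_ord r') (ltn_ord r)) ?kbasis_uniq // val_eqE (negPf neq_r) mulr0.
Qed.

Lemma coef_out i F : ~~ ((F \subset E) && (#|F| == p.+1)) -> coef i F = 0.
Proof.
move=> F_out; rewrite /coef big1 // => r _.
case: eqP => [xr|]; last by rewrite mulr0.
have : x_ r \in B p.+1 p.+2 by apply: mem_nth.
by rewrite mem_kbasis xr /= (negPf F_out) !andbF.
Qed.

Lemma kbasis_linear (r : 'I_(size (B p.+1 p.+2))) : exists i, x_ r = (inc (edge i), (x_ r).2).
Proof.
have : x_ r \in B p.+1 p.+2 by apply: mem_nth.
rewrite mem_kbasis subSnn => /and4P[_ /monos1P[s /edgeP[i ->] x1] _ _].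
by exists i; rewrite {1}[nth _ _ _]surjective_pairing x1.
Qed.

(** Evaluation of monomials at [t] is multiplicative, so evaluating the component at [F] of the
    boundary of [u] yields the contraction of the slice at the toric point. *)
Lemma cycle_toric_point : u *m kmat adj K p.+1 p.+2 = 0 -> forall (t : T -> K) F,
  contr edge (toric_point edge t) (slice coef (toric_point edge t)) F = 0.
Proof.
move=> u0 t F; set pt := toric_point edge t.
have ptE i : pt 0 i = mono t (inc (edge i)) by rewrite mxE mono_inc.
pose phi y := (y.2 == F)%:R * mono t y.1.
transitivity (\sum_r u 0 r * \sum_(y <- B p p.+2) kentry K (x_ r) y * phi y); last first.
  under eq_bigr => r _ do rewrite -sum_kbasis big_distrr /=.
  rewrite exchange_big /= big1 // => c _.
  have /rowP/(_ c) := u0; rewrite !mxE => u0c.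
  under eq_bigr => r _ do rewrite mulrA.
  rewrite -big_distrl /= [X in X * _](_ : _ = 0) ?mul0r // -[RHS]u0c.
  by apply: eq_bigr => r _; rewrite mxE.
transitivity (\sum_r u 0 r * \sum_(j | edge j \notin F) ksign K (edge j) F * pt 0 j
    * \sum_i pt 0 i * (x_ r == (inc (edge i), edge j |: F))%:R).
  under [RHS]eq_bigr => r _ do rewrite big_distrr /=.
  rewrite [RHS]exchange_big /=; apply: eq_bigr => j _.
  rewrite /slice /coef [LHS]big_distrr /=.
  under [LHS]eq_bigr => i _ do rewrite mulrA big_distrr /=.
  rewrite [LHS]exchange_big; apply: eq_bigr => r _ /=.
  by rewrite !big_distrr /=; apply: eq_bigr => i _; ring.
apply: eq_bigr => r _; congr (_ * _).
have xB : x_ r \in B p.+1 p.+2 by apply: mem_nth.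
have [i0 xE] := kbasis_linear r; set G := (x_ r).2 in xE.
have GE : G \subset E by move: xB; rewrite mem_kbasis => /and4P[].
rewrite sum_kentry // -/G sum_edges // {}xE /=.
rewrite big_mkcond [RHS]big_mkcond; apply: eq_bigr => j _.
rewrite (bigD1 i0) //= big1 ?addr0 => [|i neq_i]; last first.
  by rewrite xpair_eqE (inj_eq inc_inj) (inj_eq edge_inj) eq_sym (negPf neq_i) mulr0.
rewrite xpair_eqE eqxx /= /phi monoD -!ptE.
case: (boolP (edge j \in G)) => [jG|jG]; last first.
  case: ifP => // jF; case: eqP => [GE'|]; last by rewrite !mulr0.
  by rewrite GE' setU11 in jG.
case: (boolP (edge j \in F)) => [jF|jF] /=.
  by case: eqP => [GF|]; rewrite ?mul0r ?mulr0 // -GF setD11 in jF *.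
have -> : (G == edge j |: F) = (G :\ edge j == F).
  by apply/eqP/eqP => [->|<-]; rewrite ?setU1K // setD1K.
case: eqP => [<-|_]; last by rewrite !mul0r !mulr0.
by rewrite -{2}(setD1K jG) ksignU1_same !mulr1 !mul1r; ring.
Qed.


Hypothesis contr0_u : forall (x : 'rV_#|E|) F, F \subset E -> #|F| = p ->
  contr edge x (slice coef x) F = 0.

Lemma slice_delta i F : slice coef (delta_mx 0 i) F = coef i F.
Proof.
rewrite /slice (bigD1 i) //= mxE !eqxx mul1r big1 ?addr0 // => j neq_ji.
by rewrite mxE (negPf neq_ji) andbF mul0r.
Qed.

Lemma contr_delta i f F : contr edge (delta_mx 0 i) f F =
  (edge i \notin F)%:R * ksign K (edge i) F * f (edge i |: F).
Proof.
rewrite /contr big_mkcond (bigD1 i) //= mxE !eqxx mulr1 big1 ?addr0 => [|j neq_ji].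
  by case: ifP; rewrite ?mul1r ?mul0r.
by rewrite mxE (negPf neq_ji) andbF mulr0 mul0r; case: ifP.
Qed.

(** Polarization of the quadratic identity [contr0_u] at two basis vectors and their sum. *)
Lemma coef_polar i j F : F \subset E -> #|F| = p ->
  contr edge (delta_mx 0 i) (coef j) F + contr edge (delta_mx 0 j) (coef i) F = 0.
Proof.
move=> FE cF.
have c1 k : contr edge (delta_mx 0 k) (coef k) F = 0.
  by rewrite -(contr0_u (delta_mx 0 k) FE cF); apply: contr_ext => G; rewrite slice_delta.
have sliceE G : slice coef (1 *: delta_mx 0 i + delta_mx 0 j) G = 1 * coef i G + coef j G.
  by rewrite slice_lin !slice_delta.
have := contr0_u (1 *: delta_mx 0 i + delta_mx 0 j) FE cF.
rewrite (contr_ext edge _ sliceE) contr_linl !contr_linr.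
by rewrite !mul1r !c1 add0r addr0.
Qed.

Lemma coef_mem i F : edge i \in F -> coef i F = 0.
Proof.
move=> iF; have [/andP[FE /eqP cF]|] := boolP ((F \subset E) && (#|F| == p.+1)); last exact: coef_out.
have : contr edge (delta_mx 0 i) (coef i) (F :\ edge i) = 0.
  rewrite -[RHS](contr0_u (delta_mx 0 i) (F := F :\ edge i)).
  - by apply: contr_ext => G; rewrite slice_delta.
  - exact: subset_trans (subsetDl _ _) FE.
  - by move: cF; rewrite (cardsD1 (edge i)) iF => -[].
rewrite contr_delta setD11 mul1r setD1K //.
by move/eqP; rewrite mulf_eq0 signr_eq0 => /eqP.
Qed.

(** This independence of the chosen edge is what allows all the [coef i] to come from one exterior
    element of degree [p.+2]. *)
Lemma coef_exchange i j F : F \subset E -> #|F| = p.+2 ->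
  edge i \in F -> edge j \in F ->
  ksign K (edge i) F * coef i (F :\ edge i) = ksign K (edge j) F * coef j (F :\ edge j).
Proof.
move=> FE cF iF jF; have [->//|neq_ij] := eqVneq i j.
have neq_e : edge i != edge j by rewrite (inj_eq edge_inj).
set G := F :\ edge i :\ edge j.
have iG : edge i \notin G by rewrite !inE eqxx andbF.
have jG : edge j \notin G by rewrite !inE eqxx.
have FiE : F :\ edge i = edge j |: G by rewrite setD1K // !inE eq_sym neq_e.
have FjE : F :\ edge j = edge i |: G.
  have -> : G = F :\ edge j :\ edge i by rewrite /G !setDDl setUC.
  by rewrite setD1K // !inE neq_e.
have F_E : F = edge i |: (edge j |: G) by rewrite -FiE setD1K.
have GE : G \subset E.
  by apply: subset_trans FE; rewrite F_E setUA subsetUr.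
have cG : #|G| = p by move: cF; rewrite (cardsD1 (edge i)) iF FiE cardsU1 jG => -[].
have := coef_polar j i GE cG; rewrite !contr_delta iG jG !mul1r => polar.
have -> : ksign K (edge i) F = ksign K (edge i) (edge j |: G) by rewrite F_E ksignU1_same.
have -> : ksign K (edge j) F = ksign K (edge j) (edge i |: G).
  by rewrite F_E setUCA ksignU1_same.
rewrite FiE FjE.
have swap := ksign_swap K neq_e iG jG.
have sq k : ksign K (edge k) G * ksign K (edge k) G = 1 by apply: ksign_sqr.
set si := ksign K (edge i) G in swap polar *; set sj := ksign K (edge j) G in swap polar *.
set si' := ksign K (edge i) _ in swap *; set sj' := ksign K (edge j) _ in swap *.
have -> : si' = - (sj * si * sj').
  by rewrite -mulrA swap mulrN opprK mulrA sq mul1r.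
have -> : coef i (edge j |: G) = - (sj * si * coef j (edge i |: G)).
  rewrite -[LHS]mul1r -(sq j) -/sj -mulrA.
  by move/eqP: polar; rewrite addr_eq0 => /eqP->; rewrite mulrN mulrA.
rewrite mulrNN.
transitivity ((sj * sj) * (si * si) * (sj' * coef j (edge i |: G))); first by ring.
by rewrite !sq !mul1r.
Qed.

(** The primitive of [u]; the picked edge is immaterial on the relevant [F] by [coef_exchange]. *)
Definition potential F : K :=
  if [pick i | edge i \in F] is Some i then ksign K (edge i) F * coef i (F :\ edge i) else 0.

Lemma potentialE i F : F \subset E -> #|F| = p.+2 -> edge i \in F ->
  potential F = ksign K (edge i) F * coef i (F :\ edge i).
Proof.
move=> FE cF iF; rewrite /potential; case: pickP => [j jF|/(_ i)]; last by rewrite iF.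
exact: coef_exchange.
Qed.

Lemma boundary_contr0 : (u <= kmat adj K p.+2 p.+2)%MS.
Proof.
apply/submxP; exists (\row_r potential (nth (kdflt T) (B p.+2 p.+2) r).2).
apply/rowP => c; rewrite mxE.
under eq_bigr => r _ do rewrite !mxE /=.
rewrite (sum_kbasis _ _ (fun x => potential x.2 * kentry K x (x_ c))).
have [i xc] := kbasis_linear c; set F := (x_ c).2 in xc.
have : x_ c \in B p.+1 p.+2 by apply: mem_nth.
rewrite mem_kbasis -/F => /and4P[_ _ FE /eqP cF].
rewrite -(coef_nth xc) xc.
have kentry0 x : x \in B p.+2 p.+2 -> kentry K x (inc (edge i), F) =
    ((edge i \in x.2) && (F == x.2 :\ edge i))%:R * ksign K (edge i) x.2.
  rewrite mem_kbasis subnn inE => /and3P[_ /eqP x1 _].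
  by rewrite (surjective_pairing x) x1 kentry_inc.
have [iF|iF] := boolP (edge i \in F).
  rewrite coef_mem // big_seq big1 // => x xB; rewrite kentry0 //.
  case: andP => [[_ /eqP FE']|]; last by rewrite mul0r mulr0.
  by rewrite FE' setD11 in iF.
(* The only basis element whose boundary involves the given one. *)
set x0 := ([ffun=> 0%N] : {ffun T -> nat}, edge i |: F).
have x0E : edge i |: F \subset E by rewrite subUset sub1set edge_in.
have x0c : #|edge i |: F| = p.+2 by rewrite cardsU1 iF cF.
have x0B : x0 \in B p.+2 p.+2 by rewrite mem_kbasis leqnn subnn inE eqxx x0E x0c /=.
rewrite (bigD1_seq x0) ?kbasis_uniq //= kentry0 //= setU11 setU1K // eqxx mul1r.
rewrite (potentialE x0E x0c (setU11 _ _)) setU1K // ksignU1_same mulrAC ksign_sqr mul1r.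
rewrite big_seq_cond big1 ?addr0 // => x /andP[xB neq_x]; rewrite kentry0 //.
case: andP => [[ix /eqP FE']|]; last by rewrite mul0r mulr0.
move: xB; rewrite mem_kbasis subnn inE => /and3P[_ /eqP x1 _].
by case/eqP: neq_x; rewrite /x0 FE' setD1K // -x1 -surjective_pairing.
Qed.

End LinearStrand.

Hypothesis card_edges : forall s, s \in E -> #|s| = 2%N.

(* Green's vanishing theorem for the linear strand, [#|E| - \rank (incidence K edge)]
   being the codimension of the toric ring. *)
Lemma betti_linear_strand p : (#|E| <= \rank (incidence K edge) + p)%N ->
  betti adj K p.+1 p.+2 = 0%N.
Proof.
(* Vanishing is restated as: every cycle is a boundary. *)
move=> codim_le; apply/eqP; rewrite /betti /krank -subnDA subn_eq0 -leq_subLR -mxrank_ker.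
apply: mxrankS; apply/rV_subP => u /sub_kermxP u0.
apply: boundary_contr0 => x F FE cF.
have edgeS : F \subset [set edge i | i : 'I_#|E|].
  by apply/subsetP => s /(subsetP FE)/edgeP[i ->]; apply: imset_f.
apply: (contrs_slice_eq0 char0 edge_inj _ (cycle_toric_point u0) (k := p) (ys := [::])) => //.
  by move=> i; apply: card_edges; apply: edge_in.
by rewrite /= addsmx0.
Qed.

End Koszul.

(** * Pole order and growth *)

Section PoleOrder.
Local Open Scope ring_scope.
Import Num.Theory Order.TTheory.
Implicit Types (p h : {poly int}) (f : nat -> nat).

Lemma coef_1subXn d k : ((1 - 'X : {poly int}) ^+ d)`_k = (-1) ^+ k * 'C(d, k)%:R.
Proof.
elim: d k => [|d IHd] k; first by rewrite coef1; case: k => //= k; rewrite mulr0.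
rewrite exprS mulrBl mul1r coefB coefXM !IHd; case: k => [|k] /=.
  by rewrite subr0 !bin0.
by rewrite binS natrD exprS; ring.
Qed.

Lemma size_1subXn d : size ((1 - 'X : {poly int}) ^+ d) = d.+1.
Proof.
rewrite -[1 - _]opprB exprNn size_Msign; exact: (size_exp_XsubC d (1 : int)).
Qed.

Lemma coefM_eqr (p A B : {poly int}) n :
  (forall m, (m <= n)%N -> A`_m = B`_m) -> (p * A)`_n = (p * B)`_n.
Proof. by move=> eqAB; rewrite !coefM; apply: eq_bigr => j _; rewrite eqAB ?leq_subr. Qed.

(** Polynomial stand-in for the generating series of [f]; products with it are exact below degree
    [N]. *)
Definition trunc_series f N : {poly int} := \poly_(n < N) (f n)%:R.

Lemma coef_trunc_series f d n N : (n < N)%N ->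
  ((1 - 'X) ^+ d * trunc_series f N)`_n =
  \sum_(k < n.+1) (-1) ^+ k * 'C(d, k)%:R * (f (n - k)%N)%:R.
Proof.
move=> lt_nN; rewrite coefM; apply: eq_bigr => k _.
by rewrite coef_1subXn coef_poly (leq_ltn_trans (leq_subr _ _) lt_nN).
Qed.

Lemma sum_bin_truncE f d n :
  \sum_(k < d.+1 | (k <= n)%N) (-1) ^+ k * 'C(d, k)%:R * (f (n - k)%N)%:R =
  \sum_(k < n.+1) (-1) ^+ k * 'C(d, k)%:R * (f (n - k)%N)%:R :> int.
Proof.
pose F k : int := (-1) ^+ k * 'C(d, k)%:R * (f (n - k)%N)%:R.
rewrite (big_ord_widen_cond (n + d).+1 (fun k => (k <= n)%N) F) ?ltnS ?leq_addl //.
rewrite (big_ord_widen (n + d).+1 F) ?ltnS ?leq_addr //.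
rewrite big_mkcond [RHS]big_mkcond; apply: eq_bigr => k _ /=.
rewrite !ltnS; case: leqP => //= lt_nk; case: leqP => //= lt_kd.
by rewrite /F bin_small // mulr0 mul0r.
Qed.

Definition trunc_norm N p : int := \sum_(i < N) `|p`_i|.

(** Shifting by [L] cannot increase the truncated norm, so each factor at most doubles it. *)
Lemma trunc_norm_1subXn N L d p :
  trunc_norm N ((1 - 'X^L) ^+ d * p) <= 2 ^+ d * trunc_norm N p.
Proof.
elim: d => [|d IHd]; first by rewrite !expr0 !mul1r.
rewrite exprS -mulrA; set p' := _ * p in IHd *.
apply: (@le_trans _ _ (2 * trunc_norm N p')); last first.
  by rewrite exprS -mulrA ler_wpM2l.
rewrite mulrBl mul1r /trunc_norm mulr_natl mulr2n.
apply: (@le_trans _ _ (\sum_(i < N) (`|p'`_i| + `|('X^L * p')`_i|))).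
  by apply: ler_sum => i _; rewrite coefB ler_normB.
rewrite big_split lerD2l.
rewrite -(big_mkord xpredT (fun i => `|('X^L * p')`_i|)) -(big_mkord xpredT (fun i => `|p'`_i|)).
have [le_LN|lt_NL] := leqP L N; last first.
  rewrite big_nat big1 ?sumr_ge0 // => i /andP[_ lt_iN].
  by rewrite coefXnM (ltn_trans lt_iN lt_NL) normr0.
rewrite (big_cat_nat (leq0n L) le_LN) //= big_nat big1 ?add0r; last first.
  by move=> i /andP[_ lt_iL]; rewrite coefXnM lt_iL normr0.
rewrite -{1}[L]add0n big_addn (big_cat_nat (leq0n _) (leq_subr L N)) //=.
apply: ler_wpDr; first exact: sumr_ge0.
rewrite [leLHS]big_nat [leRHS]big_nat; apply: ler_sum => i _.
by rewrite coefXnM ltnNge leq_addl addnK.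
Qed.

(* Multiplying [(1 - 'X) ^+ d * HS = h] by [(1 + 'X + ... + 'X^(L - 1)) ^+ d] gives
   [(1 - 'X^L) ^+ d * HS]; evaluating at 1 compares [h.[1] * L ^ d] with a sum of
   [O(L)] values of [f], that is with [O(L ^ r.+1)]. *)
Lemma pole_order_le f d h r : h.[1] != 0 ->
  (forall n, h`_n = \sum_(k < d.+1 | (k <= n)%N)
     (-1) ^+ k * 'C(d, k)%:R * (f (n - k)%N)%:R) ->
  (forall n, f n <= n.+1 ^ r)%N -> (d <= r.+1)%N.
Proof.
move=> h1 hE f_le; rewrite leqNgt; apply/negP => lt_rd.
have bound L : (L ^ d <= 2 ^ d * (size h + L * d) ^ r.+1)%N.
  (* [N] bounds the size of [g], so truncation at [N] keeps all its coefficients. *)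
  set N := (size h + L * d)%N.
  pose G : {poly int} := \sum_(i < L) 'X^i.
  pose g := h * G ^+ d.
  have G1 : G.[1] = L%:R.
    rewrite horner_sum (eq_bigr (fun=> 1)) ?sumr_const ?card_ord // => i _.
    by rewrite hornerXn expr1n.
  have g1 : g.[1] = h.[1] * L%:R ^+ d by rewrite hornerM horner_exp G1.
  have size_G : (size G <= L)%N.
    apply: (leq_trans (size_sum _ _ _)); apply/bigmax_leqP => i _.
    by rewrite size_polyXn.
  have size_g : (size g <= N)%N.
    apply: leq_trans (size_polyMleq _ _) _.
    have := size_poly_exp_leq G d; rewrite /N; nia.
  have gE n : (n < N)%N -> g`_n = ((1 - 'X^L) ^+ d * trunc_series f N)`_n.
    move=> lt_nN; have -> : 1 - 'X^L = G * (1 - 'X) :> {poly int}.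
      by rewrite mulrC -[1 - 'X]opprB mulNr -subrX1 opprB.
    rewrite exprMn -mulrA /g mulrC; apply: coefM_eqr => m le_mn.
    by rewrite hE sum_bin_truncE coef_trunc_series // (leq_ltn_trans le_mn).
  have : `|g.[1]| <= 2 ^+ d * (N ^ r.+1)%:R.
    rewrite (horner_coef_wide _ size_g); under eq_bigr => i _ do rewrite expr1n mulr1.
    apply: le_trans (ler_norm_sum _ _ _) _.
    apply: (@le_trans _ _ (trunc_norm N ((1 - 'X^L) ^+ d * trunc_series f N))).
      by apply: ler_sum => i _; rewrite gE.
    apply: le_trans (trunc_norm_1subXn _ _ _ _) _.
    apply: ler_wpM2l; first exact: exprn_ge0.
    apply: (@le_trans _ _ (\sum_(i < N) (N ^ r)%:R)); last first.
      by rewrite sumr_const card_ord -mulrnA expnSr.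
    apply: ler_sum => i _; rewrite coef_poly ltn_ord normr_nat ler_nat.
    by apply: leq_trans (f_le i) _; case: (r) => [|r'] //; rewrite leq_exp2r.
  rewrite g1 normrM normrX normr_nat natrX => bnd.
  rewrite -(ler_nat int) natrM !natrX; apply: le_trans bnd.
  by rewrite ler_peMl ?exprn_ge0 // -gtz0_ge1 normr_gt0.
(* For [L] at least [size h] the bound gives [L ^ d <= C * L ^ r.+1]; as [d] is at least [r.+2],
   this fails once [L] exceeds [C]. *)
pose C := (2 ^ d * d.+1 ^ r.+1)%N.
have := bound (size h + C).+1; set L := (_ + _).+1 => bndL.
have : (L ^ r.+2 <= C * L ^ r.+1)%N.
  apply: (@leq_trans (L ^ d)); first by rewrite leq_pexp2l.
  apply: leq_trans bndL _; rewrite /C -mulnA leq_mul2l -expnMn leq_exp2r //.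
  by rewrite mulSn [(L * d)%N]mulnC leq_add2r /L; lia.
rewrite expnS leq_pmul2r ?expn_gt0 //.
by rewrite leqNgt /L ltnS leq_addl.
Qed.
End PoleOrder.

(** * Polynomial growth of the Hilbert function *)

Section HilbertGrowth.
Local Open Scope ring_scope.
Variables (T : finType) (adj : rel T) (K : fieldType).
Notation E := (edge_set adj).
Hypotheses (char0 : [pchar K] =i pred0) (card_edges : forall s, s \in E -> #|s| = 2%N).
Variable i0 : 'I_#|E|.

Let M := incidence K (@edge T adj).
(** Its columns span the directions of an affine space containing all exponent vectors of a given
    degree, which saves one dimension over [M]. *)
Let M0 : 'M[K]_(#|T|, #|E|) := \matrix_(v, i) (M v i - M v i0).

Lemma monos_affine n a : a \in monos adj n -> exists k : 'cV[K]_#|E|,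
  forall v, (a v)%:R = n%:R * M (enum_rank v) i0 + (M0 *m k) (enum_rank v) 0.
Proof.
elim: n a => [|n IHn] a.
  rewrite inE => /eqP->; exists 0 => v.
  by rewrite ffunE mul0r mulmx0 mxE addr0.
rewrite mem_undup => /allpairsP[[b s]] /= [/IHn[k kE]].
rewrite mem_enum => /edgeP[i ->] ->.
exists (k + delta_mx i 0) => v; rewrite ffunE natrD kE mulmxDr -colE.
rewrite !mxE enum_rankK ffunE -(natr1 n); ring.
Qed.

Lemma monos_le n a v : a \in monos adj n -> (a v <= n)%N.
Proof.
elim: n a => [|n IHn] a; first by rewrite inE => /eqP->; rewrite ffunE.
rewrite mem_undup => /allpairsP[[b s]] /= [/IHn b_le _ ->].
by rewrite !ffunE -addn1 leq_add ?leq_b1.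
Qed.

(** Coordinate sums are 0 on the columns of [M0] but 2 on those of [M], and 2 is nonzero in [K]. *)
Lemma rank_affine : (\rank M0 < \rank M)%N.
Proof.
rewrite -(mxrank_tr M0) -(mxrank_tr M).
have sum_col i : \sum_(v < #|T|) (enum_val v \in @edge T adj i)%:R = 2%:R :> K.
  rewrite -[in RHS](card_edges (edge_in i)) -[in RHS]sum1_card natr_sum [RHS]big_mkcond /=.
  rewrite [RHS](reindex_onto enum_val enum_rank) /=; last by move=> v _; rewrite enum_rankK.
  apply: eq_big => [v|v _]; first by rewrite enum_valK eqxx.
  by case: ifP.
have : (M0^T < M^T)%MS.
  rewrite /ltmx; apply/andP; split.
    apply/row_subP => i.
    have -> : row i M0^T = row i M^T - row i0 M^T by apply/rowP => v; rewrite !mxE.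
    by rewrite addmx_sub ?row_sub // eqmx_opp row_sub.
  apply/negP => /row_subP/(_ i0)/submxP[x xE].
  have : (row i0 M^T *m (const_mx 1 : 'cV_#|T|)) 0 0 = 0.
    rewrite xE -mulmxA [M0^T *m _](_ : _ = 0) ?mulmx0 ?mxE //.
    apply/colP => i; rewrite !mxE; under eq_bigr => v _ do rewrite !mxE mulr1.
    by rewrite sumrB !sum_col subrr.
  rewrite mxE; under eq_bigr => v _ do rewrite !mxE mulr1.
  by rewrite sum_col => /eqP; rewrite ((pcharf0P K).1 char0).
by rewrite ltmxErank => /andP[].
Qed.

(** An exponent vector is determined by its coordinates at a maximal independent set of rows of
    [M0], each at most [n]. *)
Lemma hilb_le n : (hilb adj n <= n.+1 ^ \rank M0)%N.
Proof.
pose g (a : {ffun T -> nat}) : {ffun 'I_(\rank M0) -> 'I_n.+1} :=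
  [ffun j => inord (a (enum_val (maxrankfun M0 j)))].
have g_inj : {in monos adj n &, injective g}.
  move=> a b aM bM /ffunP gab.
  have [k kE] := monos_affine aM; have [l lE] := monos_affine bM.
  have kl0 : rowsub (maxrankfun M0) M0 *m (k - l) = 0.
    rewrite mul_rowsub_mx mulmxBr; apply/colP => j; rewrite !mxE.
    have := congr1 val (gab j); rewrite !ffunE /= !inordK ?ltnS ?monos_le //.
    move/(congr1 (fun m => m%:R : K)); rewrite kE lE enum_valK.
    by move/addrI; rewrite !mxE => ->; rewrite subrr.
  have M0kl : M0 *m (k - l) = 0.
    have /submxP[X XE] : (M0 <= rowsub (maxrankfun M0) M0)%MS by rewrite eq_maxrowsub.
    by rewrite {1}XE -mulmxA kl0 mulmx0.
  apply/ffunP => v; apply: (natr_inj_char0 char0); rewrite kE lE.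
  by move/eqP: M0kl; rewrite mulmxBr subr_eq0 => /eqP->.
rewrite /hilb -(size_map g) -[X in (X ^ _)%N](card_ord n.+1) -[X in (_ ^ X)%N](card_ord (\rank M0)).
rewrite -card_ffun.
have /card_uniqP <- : uniq (map g (monos adj n)) by rewrite map_inj_in_uniq ?monos_uniq.
exact: max_card.
Qed.

End HilbertGrowth.

(** * Euler characteristic of the Koszul complex *)

Section Euler.
Local Open Scope ring_scope.
Variables (T : finType) (adj : rel T) (K : fieldType).
Hypothesis char0 : [pchar K] =i pred0.

(** Each chain dimension is a Betti number plus two consecutive ranks; the ranks telescope away. *)
Lemma euler_char (j : nat) : \sum_(i < j.+1) (-1) ^+ i * 'C(#|edge_set adj|, i)%:R * (hilb adj (j - i))%:R
  = \sum_(i < j.+1) (-1) ^+ i * (betti adj K i j)%:R :> int.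
Proof.
have telescope (g : nat -> int) m :
    \sum_(i < m) (-1) ^+ i * (g i + g i.+1) = g 0%N - (-1) ^+ m * g m.
  elim: m => [|m IHm]; first by rewrite big_ord0 mul1r subrr.
  by rewrite big_ord_recr /= IHm exprS; ring.
have krank_end : krank adj K j.+1 j = 0%N.
  apply/eqP; rewrite -leqn0 /krank; apply: leq_trans (rank_leq_row _) _.
  by rewrite /kbasis ltnn.
rewrite -[RHS]addr0 -[X in _ + X](_ : \sum_(i < j.+1) (-1) ^+ i *
    ((krank adj K i j)%:R + (krank adj K i.+1 j)%:R) = 0); last first.
  by rewrite (telescope (fun i => (krank adj K i j)%:R)) krank_end mulr0 subr0.
rewrite -big_split; apply: eq_bigr => i _ /=.
have le_ij : (i <= j)%N by rewrite -ltnS.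
have sizeE : ('C(#|edge_set adj|, i) * hilb adj (j - i) =
    betti adj K i j + (krank adj K i j + krank adj K i.+1 j))%N.
  rewrite mulnC -(size_kbasis adj le_ij) /betti -subnDA subnK //.
  exact: rank_kmat_le.
by rewrite -mulrA -natrM sizeE !natrD mulrDr.
Qed.

End Euler.

Theorem theorem4p1 (K : closedFieldType) (T : finType) (adj : rel T) :
  [pchar K]%R =i pred0 ->
  simple_graph adj ->
  reg_eq adj K 1 ->
  forall (d : nat) (h : {poly int}), is_hpoly adj d h -> size h = 2.
Proof.
move=> char0 [_ adj_irr] [[i1 [j1 [_ [betti1 ij1]]]] reg_le] d h [hE h1].
have card_edges s : s \in edge_set adj -> #|s| = 2.
  rewrite inE => /existsP[x /existsP[y /andP[adj_xy /eqP->]]].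
  by rewrite cards2; case: eqP adj_xy => // ->; rewrite adj_irr.
have j1E : j1 = i1.+1 by lia.
(* A nonzero Betti number requires a basis element, whose degree-one monomial supplies an edge. *)
have [i0] : exists i0 : 'I_#|edge_set adj|, true.
  have [x0 x0B] : exists x0, x0 \in kbasis adj i1 j1.
    case B0: (kbasis adj i1 j1) => [|x0 s]; last first.
      by exists x0; rewrite mem_head.
    by move: betti1; rewrite /betti B0.
  move: x0B; rewrite mem_kbasis j1E subSnn => /and4P[_ /monos1P[s sE _] _ _].
  by exists (enum_rank_in sE s).
move=> _; set q := #|edge_set adj| in i0 *; set r := \rank (incidence K (@edge T adj)).
have d_le_r : d <= r.
  apply: leq_trans (rank_affine char0 card_edges i0).
  exact: (pole_order_le h1 hE (hilb_le char0 i0)).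
have r_le_q : r <= q := rank_leq_col _.
pose P : {poly int} := ((1 - 'X) ^+ (q - d) * h)%R.
(* In internal degree [n.+1] the regularity leaves only homological degrees [n] and [n.+1], and
   [betti_diag] removes the second. *)
have PE n : (P`_n.+1 = (-1) ^+ n * (betti adj K n n.+1)%:R)%R.
  transitivity (((1 - 'X) ^+ q * trunc_series (hilb adj) n.+2)`_n.+1)%R.
    rewrite -(subnK (leq_trans d_le_r r_le_q)) exprD -mulrA.
    by apply: coefM_eqr => m le_mn; rewrite hE sum_bin_truncE coef_trunc_series.
  rewrite coef_trunc_series //.
  rewrite (euler_char adj char0) big_ord_recr big_ord_recr /= betti_diag // mulr0 addr0.
  rewrite big1 ?add0r // => i _.
  have [->|nz] := eqVneq (betti adj K i n.+1) 0; first by rewrite mulr0.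
  have := reg_le i n.+1 _ nz; have := ltn_ord i; lia.
have size_P : size P <= (q - r).+2.
  apply/leq_sizeP => -[|j] // lt_j; rewrite PE.
  case: j lt_j => [|p] // lt_p.
  by rewrite betti_linear_strand ?mulr0 // -leq_subLR.
have h_neq0 : h != 0%R by apply: contraNneq h1 => ->; rewrite horner0.
have size_PE : size P = size h + (q - d).
  rewrite size_mul //; first by rewrite size_1subXn addSn addnC.
  by rewrite -size_poly_gt0 size_1subXn.
(* From [size_P], [size_PE] and [d <= r] one gets [size h <= 2]; it remains to exclude a constant
   [h]. *)
apply/eqP; rewrite eqn_leq; apply/andP; split; first lia.
rewrite ltnNge; apply/negP => size_h.
have hP : h = 1%R.
  rewrite (size1_polyC (size_h : size h <= 1)) hE sum_bin_truncE.
  by rewrite big_ord1 expr0 bin0 !mul1r.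
have PEd n : (P`_n = (-1) ^+ n * 'C(q - d, n)%:R)%R by rewrite /P hP mulr1 coef_1subXn.
(* The linear coefficient of [P] is [-(q - d)] and also the nonnegative [betti 0 1]. *)
have q_eq_d : q - d = 0 by have := PE 0; rewrite PEd bin1; lia.
have := PE i1; rewrite PEd q_eq_d bin0n mulr0 => /esym/eqP.
by rewrite mulf_eq0 signr_eq0 -j1E Num.Theory.pnatr_eq0 (negPf betti1).
Qed.
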